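(* Let $K$ be a finite $k$-dimensional simplicial complex with $k\ge1$, and let $D$ be the maximum upper degree of a ridge of $K$. Assume that $\Gamma(K)$ is connected and that the signed facet-adjacency graph $\Sigma(K)$ is balanced. Then $$\lambda_1\bigl(L^{\mathrm{up}}_{k-1}(K)\bigr)=D+k$$ if and only if all $k$-faces of $K$ contain one common ridge.
   Context: A simplicial complex $K$ on a finite vertex set is a collection of subsets closed under taking subsets; a face with $m+1$ vertices has dimension $m$, and $K_j$ is the set of $j$-dimensional faces; $K$ is $k$-dimensional if $k$ is the largest dimension of a face. The $k$-faces are called facets and the $(k-1)$-faces ridges. The upper degree of a ridge $\rho$ is $d(\rho)=|\{F\in K_k:\rho\subset F\}|$. Choose an orientation (an ordering of the vertices, up to even permutations) of each face. The boundary matrix $B_k=([\sigma:F])_{\sigma\in K_{k-1},F\in K_k}$ has $[\sigma:F]=0$ if $\sigma\not\subset F$, and if $F=[v_0,\dots,v_k]$ and $\sigma=F\setminus\{v_i\}$ then $[\sigma:F]=(-1)^i\operatorname{sgn}(\pi)$, where $\pi$ is the permutation carrying $(v_0,\dots,\widehat{v_i},\dots,v_k)$ to the chosen ordering of $\sigma$. The up-Laplacian is $L^{\mathrm{up}}_{k-1}(K)=B_kB_k^{\mathsf T}$, and $\lambda_1$ denotes the largest eigenvalue. Two distinct facets $F,G$ are adjacent if they share a ridge $R=F\cap G$; then $\varepsilon(F,G)=[R:F][R:G]\in\{\pm1\}$. The signed facet-adjacency graph $\Sigma(K)$ has vertex set $K_k$, these adjacencies as edges, and $\varepsilon(F,G)$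 as the sign of the edge $FG$; $\Gamma(K)$ is its underlying unsigned graph. A signed graph is balanced if for every cycle the product of the signs of its edges is $+1$. *)

(* Defs.v *)
From HB Require Import structures.
From mathcomp Require Import all_boot all_order perm all_algebra.

Set Implicit Arguments.
Unset Strict Implicit.
Unset Printing Implicit Defensive.

Import Order.TTheory GRing.Theory Num.Theory.
Local Open Scope ring_scope.

Definition simplicial_complex (V : finType) (K : {set {set V}}) : Prop :=
  forall F G : {set V}, F \in K -> G \subset F -> G \in K.

Definition faces (V : finType) (K : {set {set V}}) (j : nat) : {set {set V}} :=
  [set F in K | #|F| == j.+1].

Definition has_dimension (V : finType) (K : {set {set V}}) (k : nat) : Prop :=
  faces K k != set0 /\ forall j : nat, faces K j != set0 -> (j <= k)%N.

(* Since [k.-1] is truncated, this is the set of (k-1)-faces only for k >= 1. *)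
Definition ridges (V : finType) (K : {set {set V}}) (k : nat) : {set {set V}} :=
  faces K k.-1.

Definition upper_degree (V : finType) (K : {set {set V}}) (k : nat)
    (rho : {set V}) : nat :=
  #|[set F in faces K k | rho \subset F]|.

Definition max_upper_degree (V : finType) (K : {set {set V}}) (k : nat) : nat :=
  \max_(rho in ridges K k) upper_degree K k rho.

(* An orientation is given by a representative ordering [o F] of each face [F];
   the orderings of different faces are unrelated to one another. *)
Definition orientation (V : finType) (K : {set {set V}})
    (o : {set V} -> seq V) : Prop :=
  forall F : {set V}, F \in K -> uniq (o F) /\ o F =i F.

(* Sign of the permutation carrying the ordering [s] to the ordering [t]. For
   duplicate-free [s] there is at most one such permutation; the value 0 occurs
   only when [t] is not a rearrangement of [s]. *)
Definition reordering_sign (V : finType) (s t : seq V) : int :=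
  if [pick p : 'S_(size s) |
        t == [seq tnth (in_tuple s) (p i) | i <- enum 'I_(size s)]]
  is Some p then (-1) ^+ odd_perm p else 0.

Definition incidence (V : finType) (o : {set V} -> seq V)
    (sigma F : {set V}) : int :=
  if [pick v in F | sigma == F :\ v] is Some v
  then (-1) ^+ index v (o F) * reordering_sign (rem v (o F)) (o sigma)
  else 0.

Definition boundary_mx (R : rcfType) (V : finType) (K : {set {set V}})
    (k : nat) (o : {set V} -> seq V) : 'M[R]_(#|ridges K k|, #|faces K k|) :=
  \matrix_(i, j) (incidence o (enum_val i) (enum_val j))%:~R.

Definition up_laplacian (R : rcfType) (V : finType) (K : {set {set V}})
    (k : nat) (o : {set V} -> seq V) : 'M[R]_#|ridges K k| :=
  boundary_mx R K k o *m (boundary_mx R K k o)^T.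

Definition is_largest_eigenvalue (R : rcfType) (n : nat) (A : 'M[R]_n)
    (lambda : R) : Prop :=
  eigenvalue A lambda /\ forall mu : R, eigenvalue A mu -> mu <= lambda.

Definition facet_adj (V : finType) (K : {set {set V}}) (k : nat) :
    rel {set V} :=
  fun F G => [&& F \in faces K k, G \in faces K k, F != G
               & F :&: G \in ridges K k].

Definition facet_sign (V : finType) (o : {set V} -> seq V)
    (F G : {set V}) : int :=
  incidence o (F :&: G) F * incidence o (F :&: G) G.

Definition connected_graph (T : finType) (A : {set T}) (e : rel T) : Prop :=
  A != set0 /\ forall x y : T, x \in A -> y \in A -> connect e x y.

Definition balanced (T : finType) (e : rel T) (sgn : T -> T -> int) : Prop :=
  forall c : seq T, (2 < size c)%N -> uniq c -> cycle e c ->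
    \prod_(x <- c) sgn x (next c x) = 1.

(* Main.v *)
Require Import Defs.
From HB Require Import structures.
From mathcomp Require Import all_boot all_order all_algebra.
From mathcomp Require Import perm complex ring lra.

Set Implicit Arguments.
Unset Strict Implicit.
Unset Printing Implicit Defensive.

Import Order.TTheory GRing.Theory Num.Theory.
Local Open Scope ring_scope.

(** The nonzero eigenvalues of [B *m B^T] are those of [M = B^T *m B], whose
rows are indexed by facets and whose off-diagonal entries are the signs of the edges
of the facet graph. Let [rho] be a ridge of maximal upper degree [D] and let
[s F = [rho : F]]. On the star of [rho], [M] is [k I + s^T s]; if the star
contains all facets, the eigenvalues of [M] are thus among [k] and [D + k].
Otherwise connectedness gives a facet [G] outside the star and adjacent to it.
Balance on triangles [F, F', G] makes all nonzero products [s F * M F G] have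
the same sign [t], so [x = D s + t e_G] satisfies [x M x^T > (D + k) x x^T], and by the
spectral theorem [M] has an eigenvalue larger than [D + k]. *)

(** * Linear algebra: shared eigenvalues, rank-one updates and the Rayleigh bound *)

Lemma eigenvalue_mulmxC (F : fieldType) (m n : nat) (A : 'M[F]_(m, n))
    (B : 'M[F]_(n, m)) (a : F) :
  a != 0 -> eigenvalue (A *m B) a -> eigenvalue (B *m A) a.
Proof.
move=> a0 /eigenvalueP[v vAB v0]; apply/eigenvalueP; exists (v *m A).
  by rewrite mulmxA -[v *m A *m B]mulmxA vAB scalemxAl.
apply: contraNneq v0 => vA0; move/eqP: vAB.
by rewrite mulmxA vA0 mul0mx eq_sym scaler_eq0 (negPf a0).
Qed.

(** An eigenvector [x] satisfies [(x s^T) s = (b - a) x]. Either [x s^T = 0], or pairing this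
    identity with [s] allows cancelling [x s^T]. *)
Lemma eigenvalue_scalar_add_rank1 (F : fieldType) (n : nat)
    (s : 'rV[F]_n) (a b : F) :
  eigenvalue (a%:M + s^T *m s) b -> b = a \/ b = a + (s *m s^T) 0 0.
Proof.
move=> /eigenvalueP[x xA x0].
have xE : (x *m s^T) 0 0 *: s = (b - a) *: x.
  rewrite scalerBl -xA mulmxDr mul_mx_scalar addrC addKr mulmxA.
  by rewrite [x *m s^T]mx11_scalar mul_scalar_mx mxE eqxx mulr1n.
have [xs0|xs0] := eqVneq ((x *m s^T) 0 0) 0.
  left; move/eqP: xE; rewrite xs0 scale0r eq_sym scaler_eq0 (negPf x0) orbF.
  by rewrite subr_eq0 => /eqP.
right; apply/(mulfI xs0)/eqP.
have := congr1 (fun y : 'rV_n => (y *m s^T) 0 0) xE.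
rewrite -!scalemxAl mxE [RHS]mxE => E.
by rewrite mulrDr E; apply/eqP; ring.
Qed.

(** Over [R[i]] the matrix becomes hermitian and has an orthonormal eigenbasis. In its coordinates
    [y] the two sides are the sums of [d_j |y_j|^2] and of [a |y_j|^2], compared term by term. *)
Lemma Rayleigh_le (R : rcfType) (n : nat) (A : 'M[R]_n) (a : R) (x : 'rV[R]_n) :
  A^T = A -> (forall b, eigenvalue A b -> b <= a) ->
  (x *m A *m x^T) 0 0 <= a * (x *m x^T) 0 0.
Proof.
move=> symA le_a; pose f : {rmorphism R -> R[i]} := real_complex R.
have f_real c : f c \is Num.real by apply/complex_realP; exists c.
have freal m p (M : 'M[R]_(m, p)) : map_mx f M \is a mxOver Num.real.
  by apply/mxOverP => i j; rewrite mxE.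
have hermA : map_mx f A \is hermsymmx.
  apply: realsym_hermsym; last exact: freal.
  by apply/is_hermitianmxP; rewrite expr0 scale1r map_mx_id // map_trmx symA.
have /orthomx_spectralP := hermitian_normalmx hermA.
have := hermitian_spectral_diag_real hermA.
set P := spectralmx _; set d := spectral_diag _ => d_real Adiag.
have P_unit : P \in unitmx by exact: spectral_unit.
have P_unitary : P \is unitarymx by exact: spectral_unitarymx.
have d_le j : d 0 j <= f a.
  have dj : d 0 j = f (complex.Re (d 0 j)).
    by rewrite /f /= RRe_real //; exact: (mxOverP d_real).
  (* As [d 0 j] is real, being a root of the characteristic polynomial descends from [R[i]] to
     [R]. *)
  rewrite dj lecR; apply: le_a; rewrite eigenvalue_root_char.
  rewrite -(fmorph_root f) map_char_poly -eigenvalue_root_char -dj.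
  apply/eigenvalueP; exists (row j P).
    rewrite -row_mul Adiag -mulmxA mulKVmx //.
    by apply/rowP => i; rewrite mul_diag_mx !mxE.
  apply: contraTneq P_unit => Pj0.
  rewrite -row_free_unit; apply/negP => /row_freeP[Q PQ].
  have := congr1 (row j) PQ; rewrite row_mul Pj0 mul0mx => /rowP/(_ j).
  by rewrite !mxE eqxx => /eqP; rewrite eq_sym oner_eq0.
have invP := invmx_unitary P_unitary.
pose y := map_mx f x *m invmx P.
have yE : P *m (map_mx f x)^T = map_mx Num.conj y^T.
  rewrite /y invP trmx_mul map_mxM !map_trmx trmxK.
  by rewrite map_mxCK realmxC ?freal.
rewrite -lecR -/f.
have -> : f ((x *m A *m x^T) 0 0) = \sum_j d 0 j * (y 0 j * (y 0 j)^* )%R.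
  transitivity ((map_mx f (x *m A *m x^T)) 0 0); first by rewrite [RHS]mxE.
  rewrite !map_mxM -map_trmx Adiag !mulmxA -/y -mulmxA yE mxE.
  by apply: eq_bigr => j _; rewrite mul_mx_diag !mxE mulrAC mulrC.
have -> : f (a * (x *m x^T) 0 0) = \sum_j f a * (y 0 j * (y 0 j)^* )%R.
  rewrite rmorphM -mulr_sumr; congr (_ * _).
  transitivity ((map_mx f (x *m x^T)) 0 0); first by rewrite [RHS]mxE.
  rewrite map_mxM -map_trmx -{1}[map_mx f x](mulmxKV P_unit) -/y -mulmxA yE mxE.
  by apply: eq_bigr => j _; rewrite !mxE.
apply: ler_sum => j _; rewrite ler_wpM2r //.
exact: mul_conjC_ge0.
Qed.

Lemma form_addr_delta (R : comNzRingType) (n : nat) (A : 'M[R]_n)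
    (s : 'rV[R]_n) (j : 'I_n) (a b : R) :
  A^T = A -> let x := a *: s + b *: delta_mx 0 j in
  (x *m A *m x^T) 0 0 =
  a ^+ 2 * (s *m A *m s^T) 0 0 + 2 * a * b * (s *m A) 0 j + b ^+ 2 * A j j.
Proof.
move=> symA x; rewrite /x linearD !linearZ /= trmx_delta !mulmxDl !mulmxDr.
rewrite -!scalemxAl -!scalemxAr -!colE -!rowE.
have -> : row j A *m s^T = (s *m col j A)^T by rewrite trmx_mul tr_col symA.
rewrite [col j (s *m A)]colE -mulmxA -colE.
have -> : (s *m A) 0 j = (s *m col j A) 0 0.
  by rewrite [in RHS]colE mulmxA -colE [RHS]mxE.
move: (s *m A *m s^T) (s *m col j A) => P Q.
by rewrite !mxE; ring.
Qed.

Lemma form_delta_row (R : comNzRingType) (n : nat) (s : 'rV[R]_n) (j : 'I_n)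
    (a b : R) :
  let x := a *: s + b *: delta_mx 0 j in
  (x *m x^T) 0 0 = a ^+ 2 * (s *m s^T) 0 0 + 2 * a * b * s 0 j + b ^+ 2.
Proof.
have := form_addr_delta s j a b (trmx1 R n).
by rewrite /= !mulmx1 => ->; rewrite [1%:M _ _]mxE eqxx mulr1.
Qed.

(** * Incidence numbers are 0 or a sign *)

Lemma reordering_sign_sqr (V : finType) (s t : seq V) :
  perm_eq s t -> reordering_sign s t ^+ 2 = 1.
Proof.
rewrite perm_sym => /(@tuple_permP _ _ _ (in_tuple s))[p tE].
rewrite /reordering_sign; case: pickP => [q _ | /(_ p)].
  by rewrite sqrr_sign.
by rewrite tE eqxx.
Qed.

Lemma subset_card1P (T : finType) (A B : {set T}) : #|B| = #|A|.+1 ->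
  reflect (exists2 v, v \in B & A = B :\ v) (A \subset B).
Proof.
move=> cB; apply: (iffP idP) => [sAB | [v _ ->]]; last exact: subsetDl.
have /cards1P[v BA] : #|B :\: A| == 1 by rewrite cardsDS // cB subSnn.
have: v \in B :\: A by rewrite BA set11.
rewrite inE => /andP[_ vB].
by exists v => //; rewrite -BA setDDr setDv set0U; apply/esym/setIidPr.
Qed.

(** By cardinality, [sigma \subset F] means that [sigma] is [F] minus one vertex, which is exactly
    when [pick] succeeds; the value is then a product of two signs. *)
Lemma incidence_sqr (V : finType) (K : {set {set V}}) (o : {set V} -> seq V)
    (sigma F : {set V}) :
  orientation K o -> sigma \in K -> F \in K -> #|F| = #|sigma|.+1 ->
  incidence o sigma F ^+ 2 = (sigma \subset F)%:R.
Proof.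
move=> ho sK FK cF; rewrite /incidence.
case: pickP => [v /andP[vF /eqP sE] | none].
  rewrite sE subsetDl exprMn sqrr_sign mul1r; apply: reordering_sign_sqr.
  have [uF oF] := ho _ FK; have [us os] := ho _ sK.
  rewrite -sE; apply: uniq_perm => // [|x]; first exact: rem_uniq.
  by rewrite mem_rem_uniq // !inE os oF sE !inE.
rewrite expr0n /=; case: (subset_card1P cF) => // -[v vF sE].
by have := none v; rewrite vF sE eqxx.
Qed.

(** * Inner products of boundary columns and the signed facet graph *)

Section Gram.

Variables (V : finType) (K : {set {set V}}) (k : nat) (o : {set V} -> seq V).
Hypotheses (hK : simplicial_complex K) (hk : (0 < k)%N) (ho : orientation K o).

(** The entries of [B^T *m B], kept in [int] and indexed by faces so that sign arguments do not
    involve [R]. *)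
Definition gram (F G : {set V}) : int :=
  \sum_(sigma in ridges K k) incidence o sigma F * incidence o sigma G.

Lemma facetP F : reflect (F \in K /\ #|F| = k.+1) (F \in faces K k).
Proof. by rewrite inE; apply: (iffP andP) => -[? /eqP]. Qed.

Lemma ridgeP rho : reflect (rho \in K /\ #|rho| = k) (rho \in ridges K k).
Proof. by rewrite inE prednK //; apply: (iffP andP) => -[? /eqP]. Qed.

Lemma facet_incidence_sqr rho F : rho \in ridges K k -> F \in faces K k ->
  incidence o rho F ^+ 2 = (rho \subset F)%:R.
Proof.
move=> /ridgeP[rK cr] /facetP[FK cF].
by apply: (incidence_sqr ho) => //; rewrite cr.
Qed.

Lemma facet_incidence_eq0 rho F : rho \in ridges K k -> F \in faces K k ->
  (incidence o rho F == 0) = ~~ (rho \subset F).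
Proof.
move=> hr hF; rewrite -sqrf_eq0 facet_incidence_sqr //.
by case: (rho \subset F).
Qed.

(** Distinct sets of size [k + 1] meet in at most [k] elements, so a common ridge fills the
    intersection. *)
Lemma facet_setI rho F G : rho \in ridges K k ->
  F \in faces K k -> G \in faces K k -> F != G ->
  rho \subset F -> rho \subset G -> F :&: G = rho.
Proof.
move=> /ridgeP[_ cr] /facetP[_ cF] /facetP[_ cG] FG rF rG.
apply/eqP; rewrite eq_sym eqEcard subsetI rF rG /= cr -ltnS -cF.
apply: proper_card; rewrite properE subsetIl subsetI subxx /=.
by apply: contra FG => FsG; rewrite eqEcard FsG cF cG leqnn.
Qed.

Lemma gramC F G : gram F G = gram G F.
Proof. by apply: eq_bigr => sigma _; rewrite mulrC. Qed.

(** Closure under subsets makes all [k + 1] subsets of [F] of size [k] ridges, and each contributes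
    a square equal to 1. *)
Lemma gram_diag F : F \in faces K k -> gram F F = k.+1%:R.
Proof.
move=> hF; have [FK cF] := facetP _ hF.
transitivity (\sum_(sigma in ridges K k) (sigma \subset F)%:R : int).
  by apply: eq_bigr => sigma hs; rewrite -expr2 facet_incidence_sqr.
rewrite -natr_sum -big_mkcondr sum1dep_card; congr _%:R.
rewrite -[RHS]binSn -cF -cards_draws; apply: eq_card => A.
rewrite !inE prednK // andbAC.
case AF: (A \subset F); rewrite ?andbF ?andbT //=.
by rewrite (hK FK AF).
Qed.

Lemma gram_offdiag F G : F \in faces K k -> G \in faces K k -> F != G ->
  gram F G = if F :&: G \in ridges K k then facet_sign o F G else 0.
Proof.
move=> hF hG FG.
have zero sigma : sigma \in ridges K k -> sigma != F :&: G ->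
    incidence o sigma F * incidence o sigma G = 0.
  move=> hs sFG; apply/eqP; rewrite mulf_eq0 !facet_incidence_eq0 //.
  rewrite -negb_and; apply: contra sFG => /andP[sF sG].
  by rewrite (facet_setI hs hF hG).
case: ifP => hI; last first.
  apply: big1 => sigma hs; apply: zero => //.
  by apply: contraFneq hI => <-.
rewrite /gram (bigD1 (F :&: G)) //= big1 ?addr0 // => sigma /andP[hs].
exact: zero.
Qed.

(** The diagonal entry splits as [1 + k] with 1 the squared incidence; off the diagonal, the ridge
    shared by [F] and [G] is [rho]. *)
Lemma gram_star rho F G : rho \in ridges K k ->
  F \in faces K k -> G \in faces K k -> rho \subset F -> rho \subset G ->
  gram F G = incidence o rho F * incidence o rho G + (F == G)%:R * k%:R.
Proof.
move=> hr hF hG rF rG; have [<-|FG] := eqVneq F G.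
  rewrite gram_diag // -expr2 facet_incidence_sqr // rF mul1r.
  by rewrite -natrD add1n.
rewrite gram_offdiag // mul0r addr0.
by rewrite /facet_sign (facet_setI hr) // hr.
Qed.

Lemma facet_adjE F G : F \in faces K k -> G \in faces K k -> F != G ->
  facet_adj K k F G = (gram F G != 0).
Proof.
move=> hF hG FG; rewrite /facet_adj hF hG FG gram_offdiag //=.
case: ifP => [hI|_]; last by rewrite eqxx.
rewrite /facet_sign mulf_eq0 !facet_incidence_eq0 //.
by rewrite subsetIl subsetIr.
Qed.

Lemma gram_sqr F G : facet_adj K k F G -> gram F G ^+ 2 = 1.
Proof.
move=> /and4P[hF hG FG hI]; rewrite gram_offdiag // hI exprMn.
by rewrite !facet_incidence_sqr // subsetIl subsetIr mulr1.
Qed.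

Lemma gram_facet_sign F G : facet_adj K k F G -> facet_sign o F G = gram F G.
Proof. by move=> /and4P[hF hG FG hI]; rewrite gram_offdiag // hI. Qed.

Lemma balanced_triangle F G H : balanced (facet_adj K k) (facet_sign o) ->
  facet_adj K k F G -> facet_adj K k G H -> facet_adj K k H F ->
  gram F G * gram G H * gram H F = 1.
Proof.
move=> hbal FG GH HF; have [_ _ nFG _] := and4P FG.
have [_ _ nGH _] := and4P GH; have [_ _ nHF _] := and4P HF.
have := hbal [:: F; G; H] isT.
rewrite /= !inE !negb_or nFG nGH (eq_sym F H) nHF FG GH HF.
move=> /(_ isT isT); rewrite !big_cons big_nil /= !eqxx.
rewrite [G == F]eq_sym [H == G]eq_sym (negPf nFG) (negPf nGH) (negPf nHF).
by rewrite mulr1 mulrA !gram_facet_sign.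
Qed.

(** If [F] differs from [F0] and is adjacent to [G], then [F], [F0], [G] form a triangle whose edge
    [F F0] has sign [[rho : F][rho : F0]], so balance makes the product 1. In the other cases it is
    a square or 0. *)
Lemma gram_star_sign (rho F F0 G : {set V}) :
  balanced (facet_adj K k) (facet_sign o) ->
  rho \in ridges K k -> F \in faces K k -> rho \subset F -> rho \subset F0 ->
  G \in faces K k -> ~~ (rho \subset G) -> facet_adj K k F0 G ->
  0 <= incidence o rho F * gram F G * (incidence o rho F0 * gram F0 G).
Proof.
move=> hbal hr hF rF rF0 hG nrG F0G; have [hF0 _ nF0G _] := and4P F0G.
have nFG : F != G by apply: contraNneq nrG => <-.
have [->|nFF0] := eqVneq F F0; first by rewrite -expr2 sqr_ge0.
have [->|] := eqVneq (gram F G) 0; first by rewrite mulr0 mul0r.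
rewrite -facet_adjE // => FG.
have FF0 : facet_adj K k F F0.
  by rewrite /facet_adj hF hF0 nFF0 (facet_setI hr).
have GF : facet_adj K k G F.
  by move: FG; rewrite /facet_adj setIC eq_sym => /and4P[-> -> -> ->].
have := balanced_triangle hbal FF0 F0G GF.
rewrite (gram_star hr hF hF0) // (negPf nFF0) mul0r addr0 (gramC G) => E.
suff -> :
  incidence o rho F * gram F G * (incidence o rho F0 * gram F0 G) = 1 by [].
by rewrite -E mulrACA [gram F G * _]mulrC mulrA.
Qed.

(** * The row of [B] at a ridge, as a test vector for [B^T *m B] *)

Variable R : rcfType.

Let B : 'M[R]_(#|ridges K k|, #|faces K k|) := boundary_mx R K k o.

Definition star_row (rho : {set V}) : 'rV[R]_#|faces K k| :=
  \row_j (incidence o rho (enum_val j))%:~R.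

Lemma gram_mxE i j : (B^T *m B) i j = (gram (enum_val i) (enum_val j))%:~R.
Proof.
rewrite mxE /gram rmorph_sum [RHS]big_enum_val; apply: eq_bigr => l _.
by rewrite !mxE rmorphM.
Qed.

Lemma star_row_norm rho : rho \in ridges K k ->
  (star_row rho *m (star_row rho)^T) 0 0 = (upper_degree K k rho)%:R.
Proof.
move=> hr; rewrite mxE /upper_degree -sum1dep_card natr_sum big_mkcondr.
rewrite [RHS]big_enum_val.
apply: eq_bigr => j _.
rewrite !mxE -rmorphM -expr2 facet_incidence_sqr ?enum_valP //.
by case: (rho \subset _).
Qed.

(** Only facets containing [rho] contribute, and [gram_star] applies to them: the rank-one part sums
    the squares of [s] to the upper degree, and the scalar part adds [k]. *)
Lemma star_row_gram rho (j : 'I_#|faces K k|) :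
  rho \in ridges K k -> rho \subset enum_val j ->
  (star_row rho *m (B^T *m B)) 0 j =
  (upper_degree K k rho + k)%:R * star_row rho 0 j.
Proof.
move=> hr rj; rewrite mxE.
transitivity (\sum_i (star_row rho 0 i * star_row rho 0 i * star_row rho 0 j +
                      (i == j)%:R * (k%:R * star_row rho 0 j))).
  apply: eq_bigr => i _; rewrite gram_mxE [star_row rho 0 i]mxE.
  have [ri|nri] := boolP (rho \subset enum_val i); last first.
    have /eqP-> : incidence o rho (enum_val i) == 0.
      by rewrite facet_incidence_eq0 ?enum_valP.
    rewrite !mul0r add0r; have [ij|] := eqVneq i j.
      by rewrite ij rj in nri.
    by rewrite mul0r.
  rewrite (gram_star hr) ?enum_valP // (inj_eq enum_val_inj) rmorphD mulrDr.
  rewrite !rmorphM !rmorph_nat [star_row rho 0 j]mxE.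
  congr (_ + _); first by rewrite mulrA.
  have [<-|] := eqVneq i j; last by rewrite !mul0r mulr0.
  by rewrite !mul1r mulrC.
rewrite big_split /= -mulr_suml natrD mulrDl; congr (_ * _ + _).
  by rewrite -star_row_norm // mxE; apply: eq_bigr => i _; rewrite [_^T _ _]mxE.
rewrite (bigD1 j) //= eqxx mul1r big1 ?addr0 // => i /negPf->.
by rewrite mul0r.
Qed.

Lemma star_row_eq0 rho (j : 'I_#|faces K k|) :
  rho \in ridges K k -> ~~ (rho \subset enum_val j) ->
  star_row rho 0 j = 0.
Proof.
move=> hr nrj; rewrite mxE.
suff /eqP-> : incidence o rho (enum_val j) == 0 by [].
by rewrite facet_incidence_eq0 ?enum_valP.
Qed.

Lemma star_row_form rho : rho \in ridges K k ->
  (star_row rho *m (B^T *m B) *m (star_row rho)^T) 0 0 =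
  (upper_degree K k rho + k)%:R * (upper_degree K k rho)%:R.
Proof.
move=> hr; rewrite mxE -star_row_norm // mxE mulr_sumr.
apply: eq_bigr => j _; rewrite mulrA [_^T _ _]mxE.
have [rj|nrj] := boolP (rho \subset enum_val j); first by rewrite star_row_gram.
by rewrite star_row_eq0 // !mulr0.
Qed.

(** No cancellation occurs: after multiplication by the sign of the [F0] term, that term is 1 and
    all others are nonnegative. *)
Lemma star_row_edge (rho F0 : {set V}) (j : 'I_#|faces K k|) :
  balanced (facet_adj K k) (facet_sign o) ->
  rho \in ridges K k -> rho \subset F0 -> ~~ (rho \subset enum_val j) ->
  facet_adj K k F0 (enum_val j) ->
  1 <= (incidence o rho F0 * gram F0 (enum_val j))%:~R *
       (star_row rho *m (B^T *m B)) 0 j.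
Proof.
move=> hbal hr rF0 nrj F0j; have [hF0 _ _ _] := and4P F0j.
set G := enum_val j in nrj F0j *; have hG : G \in faces K k by exact: enum_valP.
have -> : (star_row rho *m (B^T *m B)) 0 j =
    (\sum_(F in faces K k) incidence o rho F * gram F G)%:~R.
  rewrite mxE rmorph_sum [RHS]big_enum_val; apply: eq_bigr => i _.
  by rewrite gram_mxE mxE -rmorphM.
rewrite -rmorphM (ler_int _ 1) mulrC mulr_suml (bigD1 F0) //=.
rewrite -expr2 exprMn gram_sqr // facet_incidence_sqr // rF0 mulr1 lerDl.
apply: sumr_ge0 => F /andP[hF _].
have [rF|nrF] := boolP (rho \subset F); first exact: gram_star_sign.
have /eqP-> : incidence o rho F == 0 by rewrite facet_incidence_eq0.
by rewrite !mul0r.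
Qed.

(** * The two implications for a fixed ridge *)

Lemma eigenvalue_le_common_ridge (rho : {set V}) : balanced (facet_adj K k) (facet_sign o) ->
  connected_graph (faces K k) (facet_adj K k) -> rho \in ridges K k ->
  (0 < upper_degree K k rho)%N ->
  (forall a : R, eigenvalue (B *m B^T) a ->
     a <= (upper_degree K k rho + k)%:R) ->
  forall F, F \in faces K k -> rho \subset F.
Proof.
move=> hbal [_ hconn] hr; set D := upper_degree K k rho => D0 le_eig F hF.
apply: contraT => nrF; have [F1] := card_gt0P D0; rewrite inE => /andP[hF1 rF1].
(* A path from [F1], inside the star, to [F], outside it, has a first edge leaving the star. *)
have [F0 [G [rF0 nrG F0G]]] : exists F0 G : {set V},
    [/\ rho \subset F0, ~~ (rho \subset G) & facet_adj K k F0 G].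
  have /connectP[p] := hconn F1 F hF1 hF.
  elim: p F1 rF1 {hF1} => [|H p IH] F1 rF1 /=.
    by move=> _ FE; rewrite FE rF1 in nrF.
  move=> /andP[F1H pH] FE.
  have [rH|nrH] := boolP (rho \subset H); first exact: (IH H).
  by exists F1, H.
have [_ hG _ _] := and4P F0G.
pose j : 'I_#|faces K k| := enum_rank_in hG G.
have jE : enum_val j = G by rewrite enum_rankK_in.
have symM : (B^T *m B)^T = B^T *m B by rewrite trmx_mul trmxK.
have le_eigM a : eigenvalue (B^T *m B) a -> a <= (D + k)%:R.
  move=> Ma; have [a0|a0] := lerP a 0; first exact: le_trans a0 (ler0n _ _).
  by apply: le_eig; apply: eigenvalue_mulmxC; rewrite ?gt_eqF.
pose t : R := (incidence o rho F0 * gram F0 G)%:~R.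
have t2 : t ^+ 2 = 1.
  have [hF0 _ _ _] := and4P F0G.
  by rewrite -rmorphXn exprMn gram_sqr // facet_incidence_sqr // rF0 mulr1.
have edge : 1 <= t * (star_row rho *m (B^T *m B)) 0 j.
  by rewrite /t -jE; apply: star_row_edge; rewrite ?jE.
(* With [q] the entry of [s M] at [G], the form at this vector minus [D + k] times its squared norm
   is [2 D t q + 1 - D], since [s] vanishes at [G] and alone gives equality. As [t q >= 1], this is
   at least [D + 1]. The weight [D] on [s] lets the cross term outweigh the loss [D - 1]. *)
have := Rayleigh_le (D%:R *: star_row rho + t *: delta_mx 0 j) symM le_eigM.
rewrite form_addr_delta // form_delta_row star_row_form // star_row_norm //.
rewrite star_row_eq0 ?jE // mulr0 addr0 gram_mxE jE gram_diag // t2 -/D mul1r.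
set q : R := (_ *m _) 0 j in edge *.
rewrite [(D + k)%:R]natrD rmorph_nat [k.+1%:R]mulrS.
have D1 : 1 <= D%:R :> R by rewrite ler1n.
have : 0 <= D%:R * (t * q - 1) by rewrite mulr_ge0 ?subr_ge0 ?ler0n.
move: (D%:R : R) (k%:R : R) D1 => d c D1 le_edge le_form.
by exfalso; clear -D1 le_edge le_form; lra.
Qed.

Lemma common_ridge_largest (rho : {set V}) : rho \in ridges K k ->
  (0 < #|faces K k|)%N -> (forall F, F \in faces K k -> rho \subset F) ->
  is_largest_eigenvalue (B *m B^T) (max_upper_degree K k + k)%:R.
Proof.
move=> hr F0 hF; have degE : upper_degree K k rho = #|faces K k|.
  apply: eq_card => F; rewrite inE.
  by case: (boolP (F \in faces K k)) => // /hF->.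
(* No upper degree exceeds the number of facets, which [rho] attains. *)
have -> : max_upper_degree K k = upper_degree K k rho.
  apply/anti_leq/andP; split; last exact: leq_bigmax_cond.
  apply/bigmax_leqP => sigma _; rewrite degE; apply: subset_leq_card.
  by apply/subsetP => F; rewrite inE => /andP[].
set D := upper_degree K k rho in degE *.
have sub (j : 'I_#|faces K k|) : rho \subset enum_val j by apply/hF/enum_valP.
have a0 : (D + k)%:R != 0 :> R by rewrite pnatr_eq0 -lt0n degE addn_gt0 F0.
split.
  apply: eigenvalue_mulmxC => //; apply/eigenvalueP; exists (star_row rho).
    by apply/rowP => j; rewrite star_row_gram // [RHS]mxE.
  apply/eqP => s0; have := star_row_norm hr.
  by rewrite s0 mul0mx mxE => /esym/eqP; rewrite pnatr_eq0 -/D degE eqn0Ngt F0.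
(* Only nonzero eigenvalues pass to [B^T *m B]; nonpositive ones satisfy the bound trivially. *)
move=> b Lb; have [b0|b0] := lerP b 0; first exact: le_trans b0 (ler0n _ _).
have Mb : eigenvalue (B^T *m B) b by apply: eigenvalue_mulmxC; rewrite ?gt_eqF.
have ME : B^T *m B = k%:R%:M + (star_row rho)^T *m star_row rho.
  apply/matrixP => i j; rewrite gram_mxE (gram_star hr) ?enum_valP // !mxE.
  rewrite big_ord1 !mxE rmorphD !rmorphM !rmorph_nat addrC.
  by rewrite (inj_eq enum_val_inj) mulr_natl; case: eqP.
move: Mb; rewrite ME => /eigenvalue_scalar_add_rank1[->|->].
  by rewrite ler_nat leq_addl.
by rewrite star_row_norm // -natrD addnC.
Qed.

End Gram.

Theorem theorem4p24 (R : rcfType) (V : finType) (K : {set {set V}}) (k : nat)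
    (o : {set V} -> seq V)
    (hK : simplicial_complex K) (hk : (1 <= k)%N) (hdim : has_dimension K k)
    (ho : orientation K o)
    (hconn : connected_graph (faces K k) (facet_adj K k))
    (hbal : balanced (facet_adj K k) (facet_sign o)) :
  is_largest_eigenvalue (up_laplacian R K k o)
    (max_upper_degree K k + k)%:R
  <-> exists2 rho : {set V}, rho \in ridges K k &
        forall F : {set V}, F \in faces K k -> rho \subset F.
Proof.
have [/set0Pn[F hF] _] := hdim; split; last first.
  move=> [rho hr rho_sub]; apply: (common_ridge_largest hK hk ho R hr) => //.
  by apply/card_gt0P; exists F.
have [FK cF] := facetP _ _ _ hF.
have /set0Pn[v vF] : F != set0 by rewrite -card_gt0 cF.
(* This ridge makes the maximum range over a nonempty set, so that it is attained; lying in [F], the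
   ridge also forces the maximum to be positive. *)
have hFv : F :\ v \in ridges K k.
  apply/ridgeP => //; split; first exact: hK FK (subsetDl _ _).
  by move: cF; rewrite (cardsD1 v) vF => -[].
have [|rho hr rhoE] := @eq_bigmax_cond _ (mem (ridges K k)) (upper_degree K k).
  by apply/card_gt0P; exists (F :\ v).
rewrite /max_upper_degree rhoE => -[_ le_eig]; exists rho => //.
apply: (eigenvalue_le_common_ridge hK hk ho hbal hconn hr _ le_eig).
rewrite -rhoE; apply: leq_trans (leq_bigmax_cond _ hFv).
by apply/card_gt0P; exists F; rewrite inE hF subsetDl.
Qed.
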